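(* Let $a\ge 1$ be an integer, and let $f_0$ be defined by $f_0(1)=1$, $f_0(2)=a$, and $f_0(n+2)=(a-1)f_0(n+1)$ for $n\ge 1$. For $1\le k\le n$ let $$c_1(n,k)=\sum_{i_1+i_2+\cdots+i_k=n}f_0(i_1)f_0(i_2)\cdots f_0(i_k),$$ the sum being over positive integers $i_1,\ldots,i_k$. Then $c_1(n,n)=1$ for all $n\ge 1$, and for $1\le k<n$, $$c_1(n,k)=\sum_{i=0}^{k-1}\binom{k}{i}\binom{n-k-1}{k-i-1}a^{k-i}(a-1)^{n-2k+i}.$$
   Context: Terms with $i<2k-n$ (for which the binomial coefficient $\binom{n-k-1}{k-i-1}$ vanishes and the exponent $n-2k+i$ is negative) are taken to be $0$; also $0^0=1$. *)

(* Defs.v *)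
From mathcomp Require Import all_boot all_order all_algebra.

Set Implicit Arguments.
Unset Strict Implicit.
Unset Printing Implicit Defensive.

Import Order.TTheory GRing.Theory Num.Theory.
Local Open Scope ring_scope.

(* The sum of f(i_1) ... f(i_k) over all k-tuples of positive integers with
   i_1 + ... + i_k = n. Each part of such a tuple is at most n, so the tuples
   are exactly the finite functions 'I_k -> {0, ..., n} with positive values
   and sum n. *)
Definition c1 (f : nat -> int) (n k : nat) : int :=
  \sum_(t : {ffun 'I_k -> 'I_n.+1}
        | [forall j, (0 < t j)%N] && ((\sum_(j < k) t j)%N == n))
     \prod_(j < k) f (t j).

(* Main.v *)
Require Import Defs.
From mathcomp Require Import all_boot all_order all_algebra.
From mathcomp Require Import zify.

Set Implicit Arguments.
Unset Strict Implicit.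
Unset Printing Implicit Defensive.

Import Order.TTheory GRing.Theory Num.Theory.
Local Open Scope ring_scope.

(** The compositions of [n] into [k] parts are counted, with weight [f0] on
    each part, by the coefficient of [X^n] in the [k]-th power of the
    generating polynomial of [f0] cut off after degree [n] ([c1_coef]).
    Writing [b = a - 1], the recurrence gives [f0 (m + 2) = a b^m], so this
    polynomial is [X (1 + a X Q)], where [Q = 1 + b X + b^2 X^2 + ...] is a
    truncated geometric series ([genpolyE]).  The binomial theorem then gives

      [X^k (1 + a X Q)^k = \sum_i 'C(k, i) a^(k-i) X^(k + (k-i)) Q^(k-i)],

    and the coefficient of [X^m] in [Q^(j+1)] is ['C(m + j, j) b^m]
    ([coef_geopoly_exp]), as for [(1 - b X)^-(j+1)].  With [j + 1 = k - i] and
    [m = n - 2k + i] this is the [i]-th term of the claimed sum.  The term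
    [i = k] is [X^k], which contributes only when [n = k]; conversely for
    [n = k] every other term is divisible by [X^(n+1)], and only the
    contribution 1 of [X^k] remains. *)

(** The zero constant term encodes that the parts of a composition are
    positive. *)
Definition genpoly (f : nat -> int) (n : nat) : {poly int} :=
  \poly_(i < n.+1) (if (0 < i)%N then f i else 0).

Definition geopoly (b : int) (N : nat) : {poly int} := \poly_(m < N) b ^+ m.

(** Expanding the [k]-th power chooses a monomial in each factor; the choices
    are the finite functions over which [c1] sums. *)
Lemma c1_coef (f : nat -> int) (n k : nat) :
  c1 f n k = (genpoly f n ^+ k)`_n.
Proof.
have -> : genpoly f n ^+ k = \prod_(j < k) genpoly f n.
  by rewrite prodr_const card_ord.
rewrite /genpoly; under eq_bigr do rewrite poly_def.
rewrite bigA_distr_bigA /= coef_sum /c1 big_mkcond /=.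
apply: eq_bigr => t _.
rewrite scaler_prod prodrXr coefZ coefXn eq_sym.
case: (boolP [forall j, (0 < t j)%N]) => [/forallP tpos | /forallPn[j tj0]] /=.
  case: eqP => _; last by rewrite mulr0.
  by rewrite mulr1; apply: eq_bigr => j _; rewrite tpos.
by rewrite (bigD1 j) //= (negbTE tj0) !mul0r.
Qed.

Lemma hockey_stick (m j : nat) :
  (\sum_(l < m.+1) 'C(l + j, j))%N = 'C(m + j.+1, j.+1).
Proof.
elim: m => [|m IHm]; first by rewrite big_ord1 !binn.
by rewrite big_ord_recr IHm /= [in RHS]addSn [in RHS]binS addSnnS.
Qed.

(** Below degree [N] the truncation is invisible, so the coefficients are those
    of [(1 - b X)^-(j+1)].  In the convolution of [Q^(j+1)] with [Q] the powers
    of [b] combine to [b ^+ m] and the binomial coefficients add up along a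
    diagonal of Pascal's triangle. *)
Lemma coef_geopoly_exp (b : int) (N j m : nat) : (m < N)%N ->
  (geopoly b N ^+ j.+1)`_m = 'C(m + j, j)%:R * b ^+ m.
Proof.
elim: j m => [|j IHj] m ltmN; first by rewrite coef_poly ltmN bin0 mul1r.
rewrite exprSr coefM -hockey_stick natr_sum mulr_suml.
apply: eq_bigr => l _.
have lelm : (l <= m)%N by rewrite -ltnS.
rewrite IHj ?(leq_ltn_trans lelm) // coef_poly.
by rewrite (leq_ltn_trans (leq_subr l m)) // -mulrA -exprD subnKC.
Qed.

Section GeometricTail.

Variables (a : int) (f0 : nat -> int).
Hypotheses (f0_1 : f0 1%N = 1) (f0_2 : f0 2%N = a).
Hypothesis f0_rec : forall n : nat, (1 <= n)%N ->
  f0 (n + 2)%N = (a - 1) * f0 (n + 1)%N.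

Lemma f0_closed (m : nat) : f0 m.+2 = a * (a - 1) ^+ m.
Proof.
elim: m => [|m IHm]; first by rewrite f0_2 mulr1.
by rewrite -addn2 f0_rec // addn1 IHm exprS mulrCA.
Qed.

(** The factor [X^2] in front of the geometric part shifts degrees by two, so
    [n - 1] geometric terms end exactly at degree [n]. *)
Lemma genpolyE (n : nat) : (0 < n)%N ->
  genpoly f0 n = 'X * (a *: ('X * geopoly (a - 1) n.-1) + 1).
Proof.
move=> n_gt0; apply/polyP => -[|[|m]].
- by rewrite coef_poly coefXM.
- by rewrite coef_poly coefXM /= coefD coefZ coefXM mulr0 add0r coef1 ltnS n_gt0.
rewrite coef_poly coefXM /= coefD coefZ coefXM /= coef1 addr0 coef_poly f0_closed.
have -> : (m.+2 < n.+1)%N = (m < n.-1)%N by lia.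
by case: ifP; rewrite ?mulr0.
Qed.

Lemma c1_binomial (n k : nat) : (0 < n)%N ->
  c1 f0 n k = \sum_(i < k.+1) 'C(k, i)%:R * (a ^+ (k - i)
     * ('X^(k + (k - i)) * geopoly (a - 1) n.-1 ^+ (k - i))`_n).
Proof.
move=> n_gt0; rewrite c1_coef genpolyE // exprMn exprDn mulr_sumr coef_sum.
apply: eq_bigr => i _.
rewrite expr1n mulr1 exprZn exprMn mulrnAr -scalerAr.
by rewrite coefMn coefZ mulr_natl exprD -(mulrA ('X^k)).
Qed.

End GeometricTail.

Theorem proposition4 (a : int) (ha : 1 <= a) (f0 : nat -> int)
    (f0_1 : f0 1%N = 1) (f0_2 : f0 2%N = a)
    (f0_rec : forall n : nat, (1 <= n)%N ->
       f0 (n + 2)%N = (a - 1) * f0 (n + 1)%N) :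
  (forall n : nat, (1 <= n)%N -> c1 f0 n n = 1) /\
  (forall n k : nat, (1 <= k)%N -> (k < n)%N ->
     c1 f0 n k =
       \sum_(0 <= i < k | (2 * k <= n + i)%N)
          ('C(k, i))%:R * ('C(n - k - 1, k - i - 1))%:R
            * a ^+ (k - i) * (a - 1) ^+ (n + i - 2 * k)).
Proof.
split=> [n n_gt0 | n k k_gt0 ltkn].
  rewrite (c1_binomial f0_1 f0_2 f0_rec) // big_ord_recr /= big1 => [|i _].
    by rewrite add0r binn subnn addn0 mulr1 coefXn eqxx !mulr1.
  (* For [k = n] the terms with [i < k] have order greater than [n]. *)
  rewrite coefXnM; have -> : (n < n + (n - i))%N by have := ltn_ord i; lia.
  by rewrite !mulr0.
rewrite (c1_binomial f0_1 f0_2 f0_rec) ?(leq_trans _ ltkn) //.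
(* The term [i = k] is [X^k], which has no coefficient in degree [n > k]. *)
rewrite big_ord_recr /= subnn addn0 mulr1 coefXn gtn_eqF // !mulr0 addr0.
rewrite big_mkord [RHS]big_mkcond; apply: eq_bigr => -[i ltik] _ /=.
rewrite coefXnM; case: (leqP (2 * k) (n + i)) => [le2k | gt2k]; last first.
  have -> : (n < k + (k - i))%N by lia.
  by rewrite !mulr0.
have -> : (n < k + (k - i))%N = false by lia.
have [j kiE] : exists j, (k - i)%N = j.+1 by exists (k - i).-1; lia.
rewrite kiE subSS subn0 coef_geopoly_exp; last by lia.
have -> : (n - (k + j.+1) = n + i - 2 * k)%N by lia.
have -> : (n + i - 2 * k + j = n - k - 1)%N by lia.
by rewrite -!mulrA; congr (_ * _); rewrite mulrCA.
Qed.
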